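(* A totally umbilical hypersurface $\iota:M^m\to N^{m+1}$ in an Einstein space $N^{m+1}$ is $H$-tensional if and only if it is minimal.
   Context: A Riemannian submanifold $\iota:(M^m,g)\to(N^n,h)$ is a (connected) manifold $M$ together with an isometric immersion $\iota$; it is a hypersurface if $n=m+1$. Its mean curvature vector is $H=\frac1m\operatorname{Tr}_g B=\frac1m\tau(\iota)$, where $B$ is the second fundamental form and $\tau(\iota)=\sum_{i=1}^m\{\nabla^\iota_{e_i}d\iota(e_i)-d\iota(\nabla_{e_i}e_i)\}$ is the tension field ($\{e_i\}$ a local orthonormal frame of $(M,g)$, $\nabla$ the Levi-Civita connection of $(M,g)$, $\nabla^\iota$ the connection on $\iota^{-1}TN$ induced by the Levi-Civita connection of $(N,h)$). $M$ is minimal if $H=0$. A hypersurface is totally umbilical if, at every point, its shape operator (with respect to a unit normal) is a multiple of the identity, i.e. all principal curvatures coincide at each point. An Einstein space is a Riemannian manifold whose Ricci tensor is a constant multiple of the metric. The rough Laplacian on sections $\xi$ of $\iota^{-1}TN$ is $\Delta^\iota\xi=-\sum_{i=1}^m(\nabla^\iota_{e_i}\nabla^\iota_{e_i}\xi-\nabla^\iota_{\nabla_{e_i}e_i}\xi)$. $M$ is called $H$-tensional if $\Delta^\iota\tau(\iota)=0$. *)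

(* Defs.v *)
From HB Require Import structures.
From mathcomp Require Import all_boot all_order all_algebra.
From mathcomp Require Import all_classical all_reals all_analysis.

Set Implicit Arguments.
Unset Strict Implicit.
Unset Printing Implicit Defensive.

Import Order.TTheory GRing.Theory Num.Theory.
Import numFieldNormedType.Exports.

Local Open Scope classical_set_scope.
Local Open Scope ring_scope.

Section Smooth.
Context {R : realType} {V W : normedModType R}.

(* C^k on an open set U; the values of [f] outside [U] are irrelevant. *)
Fixpoint Ck_on (k : nat) (U : set V) (f : V -> W) : Prop :=
  match k with
  | 0 => forall x, U x -> {for x, continuous f}
  | k'.+1 => (forall x, U x -> differentiable f x) /\
             (forall v : V, Ck_on k' U (fun x => 'D_v f x))
  end.

Definition smooth_on (U : set V) (f : V -> W) : Prop :=
  forall k, Ck_on k U f.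

End Smooth.

(* Coordinates are row vectors.  [coord] and [coord_inv] are total functions,
   meaningful only on [dom] and on [coord @` dom] respectively. *)
Record chart (R : realType) (n : nat) (M : topologicalType) := Chart {
  dom : set M;
  coord : M -> 'rV[R]_n;
  coord_inv : 'rV[R]_n -> M;
  dom_open : open dom;
  img_open : open (coord @` dom);
  coordK : forall p, dom p -> coord_inv (coord p) = p;
  coord_continuous : forall p, dom p -> {for p, continuous coord};
  coord_inv_continuous :
    forall x, (coord @` dom) x -> {for x, continuous coord_inv}
}.

Definition img (R : realType) (n : nat) (M : topologicalType)
  (c : chart R n M) : set 'rV[R]_n := coord c @` dom c.

Definition transition (R : realType) (n : nat) (M : topologicalType)
  (c d : chart R n M) : 'rV[R]_n -> 'rV[R]_n := coord d \o coord_inv c.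

Definition overlap (R : realType) (n : nat) (M : topologicalType)
  (c d : chart R n M) : set 'rV[R]_n := coord c @` (dom c `&` dom d).

Record smooth_manifold (R : realType) (n : nat) := SmoothManifold {
  carrier :> topologicalType;
  manifold_hausdorff : hausdorff_space carrier;
  manifold_second_countable : second_countable (T := carrier);
  atlas : set (chart R n carrier);
  atlas_cover : forall p : carrier, exists2 c, atlas c & dom c p;
  atlas_smooth : forall c d, atlas c -> atlas d ->
    smooth_on (overlap c d) (transition c d)
}.

Definition bform (R : realType) (n : nat) (A : 'M[R]_n) (u v : 'rV[R]_n) : R :=
  (u *m A *m v^T) 0 0.

(* [gram c x] is the matrix (g_ij) of the metric in the chart [c] at the point
   with coordinates [x]; [gram_compat] is the (0,2)-tensor transformation
   law. *)
Record riemannian_manifold (R : realType) (n : nat) := RiemannianManifold {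
  manifold :> smooth_manifold R n;
  gram : chart R n manifold -> 'rV[R]_n -> 'M[R]_n;
  gram_smooth : forall c, atlas c ->
    forall i j, smooth_on (img c) (fun x => gram c x i j);
  gram_sym : forall c, atlas c -> forall x, img c x -> (gram c x)^T = gram c x;
  gram_posdef : forall c, atlas c -> forall x, img c x ->
    forall u, u != 0 -> 0 < bform (gram c x) u u;
  gram_compat : forall c d, atlas c -> atlas d -> forall x, overlap c d x ->
    forall u v, bform (gram c x) u v =
      bform (gram d (transition c d x))
        ('d (transition c d) x u) ('d (transition c d) x v)
}.

(* In a chart of dimension n with Gram field [G], a vector field is given by
   its components, a function 'rV_n -> 'rV_n. *)
Section LeviCivita.
Context {R : realType} {n : nat}.
Variable G : 'rV[R]_n -> 'M[R]_n.

Definition partial (i : 'I_n) (f : 'rV[R]_n -> R) (x : 'rV[R]_n) : R :=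
  'D_(delta_mx 0 i) f x.

(* Gamma^k_ij = 1/2 sum_l (d_i g_jl + d_j g_il - d_l g_ij) g^lk *)
Definition christoffel (x : 'rV[R]_n) (i j k : 'I_n) : R :=
  2^-1 * \sum_l (partial i (fun y => G y j l) x
               + partial j (fun y => G y i l) x
               - partial l (fun y => G y i j) x) * (invmx (G x)) l k.

Definition Gamma (x u v : 'rV[R]_n) : 'rV[R]_n :=
  \row_k \sum_i \sum_j christoffel x i j k * u 0 i * v 0 j.

Definition nabla (X Y : 'rV[R]_n -> 'rV[R]_n) (x : 'rV[R]_n) : 'rV[R]_n :=
  'D_(X x) Y x + Gamma x (X x) (Y x).

Definition lie_bracket (X Y : 'rV[R]_n -> 'rV[R]_n) (x : 'rV[R]_n) :
  'rV[R]_n := 'D_(X x) Y x - 'D_(Y x) X x.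

Definition curvature (X Y Z : 'rV[R]_n -> 'rV[R]_n) (x : 'rV[R]_n) :
  'rV[R]_n :=
  nabla X (nabla Y Z) x - nabla Y (nabla X Z) x - nabla (lie_bracket X Y) Z x.

(* Ric(v, w) = trace of u |-> R(u, v)w; the curvature being tensorial, the
   tangent vectors are extended by constant components. *)
Definition ricci (x v w : 'rV[R]_n) : R :=
  \sum_k (curvature (cst (delta_mx 0 k)) (cst v) (cst w) x) 0 k.

End LeviCivita.

Definition einstein (R : realType) (n : nat) (N : riemannian_manifold R n) :
  Prop :=
  exists lam : R, forall c, atlas c -> forall x, @img R n N c x ->
    forall v w, ricci (gram c) x v w = lam * bform (gram c x) v w.

(* [F] is the coordinate expression of the map, [G] and [K] are the Gram fields
   of the source and of the target.  A section of the pull-back of the tangent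
   bundle of the target is given by its components, a function
   'rV_m -> 'rV_n. *)
Section AlongMap.
Context {R : realType} {m n : nat}.
Variables (G : 'rV[R]_m -> 'M[R]_m) (K : 'rV[R]_n -> 'M[R]_n).
Variable F : 'rV[R]_m -> 'rV[R]_n.

Definition push (X : 'rV[R]_m -> 'rV[R]_m) (x : 'rV[R]_m) : 'rV[R]_n :=
  'd F x (X x).

Definition nabla_along (X : 'rV[R]_m -> 'rV[R]_m) (xi : 'rV[R]_m -> 'rV[R]_n)
    (x : 'rV[R]_m) : 'rV[R]_n :=
  'D_(X x) xi x + Gamma K (F x) ('d F x (X x)) (xi x).

Definition second_form (X Y : 'rV[R]_m -> 'rV[R]_m) (x : 'rV[R]_m) :
    'rV[R]_n :=
  nabla_along X (push Y) x - 'd F x (nabla G X Y x).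

Definition orthonormal_frame (U : set 'rV[R]_m)
    (e : 'I_m -> 'rV[R]_m -> 'rV[R]_m) : Prop :=
  (forall i, smooth_on U (e i)) /\
  (forall x, U x -> forall i j, bform (G x) (e i x) (e j x) = (i == j)%:R).

Definition tension (e : 'I_m -> 'rV[R]_m -> 'rV[R]_m) (x : 'rV[R]_m) :
    'rV[R]_n :=
  \sum_i second_form (e i) (e i) x.

Definition mean_curvature (e : 'I_m -> 'rV[R]_m -> 'rV[R]_m) (x : 'rV[R]_m) :
    'rV[R]_n :=
  m%:R^-1 *: tension e x.

Definition rough_laplacian (e : 'I_m -> 'rV[R]_m -> 'rV[R]_m)
    (xi : 'rV[R]_m -> 'rV[R]_n) (x : 'rV[R]_m) : 'rV[R]_n :=
  - \sum_i (nabla_along (e i) (nabla_along (e i) xi) x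
            - nabla_along (nabla G (e i) (e i)) xi x).

Definition unit_normal (x : 'rV[R]_m) (eta : 'rV[R]_n) : Prop :=
  bform (K (F x)) eta eta = 1 /\
  forall u, bform (K (F x)) ('d F x u) eta = 0.

(* The matrix A, acting on row vectors on the right, characterized by
   g(u A, v) = h(B(u, v), eta). *)
Definition shape_operator (x : 'rV[R]_m) (eta : 'rV[R]_n) : 'M[R]_m :=
  (\matrix_(i, j) bform (K (F x))
     (second_form (cst (delta_mx 0 i)) (cst (delta_mx 0 j)) x) eta)
  *m invmx (G x).

End AlongMap.

Section Submanifold.
Context {R : realType} {m n : nat}.
Variables (M : riemannian_manifold R m) (N : riemannian_manifold R n).
Variable iota : M -> N.

Definition local_map (c : chart R m M) (d : chart R n N) :
  'rV[R]_m -> 'rV[R]_n := coord d \o iota \o coord_inv c.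

Definition local_dom (c : chart R m M) (d : chart R n N) : set 'rV[R]_m :=
  coord c @` (dom c `&` iota @^-1` dom d).

Definition smooth_map : Prop :=
  continuous iota /\
  forall c d, atlas c -> atlas d -> smooth_on (local_dom c d) (local_map c d).

Definition immersion : Prop :=
  smooth_map /\
  forall c d, atlas c -> atlas d -> forall x, local_dom c d x ->
    injective ('d (local_map c d) x).

Definition isometric : Prop :=
  forall c d, atlas c -> atlas d -> forall x, local_dom c d x ->
  forall u v, bform (gram c x) u v =
    bform (gram d (local_map c d x))
      ('d (local_map c d) x u) ('d (local_map c d) x v).

Definition riemannian_submanifold : Prop :=
  [/\ connected [set: M], immersion & isometric].

Definition totally_umbilical : Prop :=
  forall c d, atlas c -> atlas d -> forall x, local_dom c d x ->
  forall eta, unit_normal (gram d) (local_map c d) x eta ->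
  exists lam : R,
    shape_operator (gram c) (gram d) (local_map c d) x eta = lam%:M.

(* The tension field and the rough Laplacian do not depend on the orthonormal
   frame used to compute them, and local orthonormal frames exist around every
   point. *)
Definition minimal : Prop :=
  forall c d, atlas c -> atlas d ->
  forall U e, open U -> U `<=` local_dom c d ->
  orthonormal_frame (gram c) U e ->
  forall x, U x ->
    mean_curvature (gram c) (gram d) (local_map c d) e x = 0.

Definition H_tensional : Prop :=
  forall c d, atlas c -> atlas d ->
  forall U e, open U -> U `<=` local_dom c d ->
  orthonormal_frame (gram c) U e ->
  forall x, U x ->
    rough_laplacian (gram c) (gram d) (local_map c d) e
      (tension (gram c) (gram d) (local_map c d) e) x = 0.

End Submanifold.

(* Main.v *)
Require Import Defs.
From HB Require Import structures.
From mathcomp Require Import all_boot all_order all_algebra.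
From mathcomp Require Import all_classical all_reals all_analysis.
From mathcomp Require Import ring lra.

Set Implicit Arguments.
Unset Strict Implicit.
Unset Printing Implicit Defensive.

Import Order.TTheory GRing.Theory Num.Theory.
Import numFieldNormedType.Exports.

Local Open Scope classical_set_scope.
Local Open Scope ring_scope.

(** Write [h] for the metric of the target along the map, [g] for the metric of
    the source, [B] for the second fundamental form, [tau] for the tension
    field and [phi = h(tau, tau)].  The substance is that a harmonic tension
    field vanishes; the converse holds because [tau = 0] on an open set.

    Everything is computed in charts.  Two classical facts are established
    there first: the connection along a map is compatible with the metric
    ([metric_compat]), and [B] takes normal values ([second_form_cst_normal]).
    The latter is the uniqueness of the Levi-Civita connection of [g]: by
    Koszul's formula the tangential part of the derivative of the pushed
    forward coordinate fields is determined by the derivatives of [g], once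
    that derivative is symmetric in its two arguments, which is the symmetry of
    second derivatives ([schwarz]).

    If all shape operators are scalar, then [B(X, Y) = g(X, Y) tau / m]
    ([umbilical_second_form]).  Hence, with [c = 1 / m], differentiating
    [h(tau, dF w) = 0] gives
      [h(nabla_X tau, dF w) = - c phi g(X, w)],
    and differentiating once more along an orthonormal frame [e_i] gives
      [h(nabla_i nabla_i tau - nabla_(nabla_i e_i) tau, dF w)
         = - (3/2) c (D_(e_i) phi) g(e_i, w)].
    Summing over [i] with [w = e_k], the tangential part of the equation
    [Delta tau = 0] says that all derivatives of [phi] vanish.  Its component
    along [tau] is then
      [0 = h(Delta tau, tau) = sum_i h(nabla_i tau, nabla_i tau)],
    because [h(nabla_i tau, tau) = D_(e_i) phi / 2 = 0].  So [nabla_i tau = 0],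
    and the first identity with [X = w = e_i] leaves [c phi = 0], that is
    [tau = 0] ([umbilical_section_eq0]). *)

(** * Closure properties of smooth functions *)

Section Congruence.
Context {R : realType} {V W : normedModType R}.
Implicit Types (f g : V -> W) (U : set V).

Lemma near_eq_differentiable f g x :
  (\near x, f x = g x) -> differentiable f x -> differentiable g x.
Proof.
move=> fg df; have [cdf /eqaddoP fE] := (diff_locallyP _ _).1 df.
have gE : g \o shift x = cst (g x) + 'd f x +o_0 id.
  apply/eqaddoP => e e0; have := fE _ e0; apply: filter_app.
  have fgx : f x = g x := nbhs_singleton fg.
  have fg0 : \forall h \near (0 : V), f (h + x) = g (h + x).
    by move: fg; rewrite (near_shift 0 x) subr0.
  near=> h => /=; rewrite -fgx.
  suff fgh : f (h + x) = g (h + x) by rewrite -!/(_ - _) !fctE /= fgh.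
  by near: h.
apply/diff_locallyP; have dgf := diff_unique cdf gE.
by rewrite dgf.
Unshelve. all: by end_near. Qed.

Lemma near_in_open (U : set V) (P : V -> Prop) x :
  open U -> U x -> (forall y, U y -> P y) -> \near x, P x.
Proof.
move=> oU Ux UP; apply: (filterS UP).
exact: open_nbhs_nbhs.
Qed.

Lemma eq_on_derive U f g x v :
  open U -> (forall y, U y -> f y = g y) -> U x -> 'D_v f x = 'D_v g x.
Proof. by move=> oU fg Ux; apply: near_eq_derive; exact: near_in_open fg. Qed.

(** Formulas for derivatives hold only on [U], whereas [Ck_on] differentiates
    total functions; the inductions below need that values off [U] are
    irrelevant. *)
Lemma eq_Ck_on k U f g :
  open U -> (forall x, U x -> f x = g x) -> Ck_on k U f -> Ck_on k U g.
Proof.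
move=> oU; elim: k f g => [|k IH] f g fg /=.
  move=> cf x Ux; rewrite /prop_for/continuous_at -fg//.
  apply: cvg_trans (cf x Ux); apply: near_eq_cvg.
  by apply: (near_in_open oU Ux) => y /fg.
move=> [df Df]; split=> [x Ux|v].
  by apply: near_eq_differentiable (df x Ux); exact: near_in_open fg.
by apply: IH (Df v) => x Ux; exact: eq_on_derive fg Ux.
Qed.

Lemma Ck_onS k U f : Ck_on k.+1 U f -> Ck_on k U f.
Proof.
elim: k f => [|k IH] f /=.
  by move=> [df _] x Ux; exact/differentiable_continuous/df.
by move=> [df Df]; split=> // v; exact: IH (Df v).
Qed.

Lemma sub_Ck_on k U (U' : set V) f : U' `<=` U -> Ck_on k U f -> Ck_on k U' f.
Proof.
move=> U'U; elim: k f => [|k IH] f /= => [cf x /U'U/cf //|[df Df]].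
by split=> [x /U'U/df //|v]; exact: IH.
Qed.

Lemma Ck_cst k U (a : W) : Ck_on k U (fun=> a).
Proof.
elim: k a => [|k IH] a /=; first by move=> x _; exact: cst_continuous.
split=> [x _|v]; first exact: (differentiable_cst a x).
have -> : (fun x : V => 'D_v (fun=> a) x) = (fun=> 0 : W).
  by apply/funext => x; exact: derive_cst.
exact: IH.
Qed.

Lemma Ck_add k U f g : open U ->
  Ck_on k U f -> Ck_on k U g -> Ck_on k U (fun x => f x + g x).
Proof.
move=> oU; elim: k f g => [|k IH] f g /=.
  by move=> cf cg x Ux; apply: cvgD; [exact: cf|exact: cg].
move=> [df Df] [dg Dg]; split=> [x Ux|v].
  by apply: differentiableD; [exact: df|exact: dg].
apply: eq_Ck_on (IH _ _ (Df v) (Dg v)) => // x Ux.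
by rewrite [RHS]deriveD//; apply: diff_derivable; [exact: df|exact: dg].
Qed.

Lemma smooth_differentiable U f x : smooth_on U f -> U x -> differentiable f x.
Proof. by move=> /(_ 1%N)[df _] /df. Qed.

Lemma smooth_derive U f v : smooth_on U f -> smooth_on U (fun x => 'D_v f x).
Proof. by move=> sf k; have [_] := sf k.+1; exact. Qed.

Lemma smooth_eq U f g : open U -> (forall x, U x -> f x = g x) ->
  smooth_on U f -> smooth_on U g.
Proof. by move=> oU fg sf k; exact: eq_Ck_on fg (sf k). Qed.

Lemma smooth_subset U (U' : set V) f :
  U' `<=` U -> smooth_on U f -> smooth_on U' f.
Proof. by move=> U'U sf k; exact: sub_Ck_on (sf k). Qed.

Lemma smooth_cst U (a : W) : smooth_on U (fun=> a).
Proof. by move=> k; exact: Ck_cst. Qed.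

Lemma smooth_add U f g : open U -> smooth_on U f -> smooth_on U g ->
  smooth_on U (fun x => f x + g x).
Proof. by move=> oU sf sg k; exact: Ck_add. Qed.

Lemma Ck_sum k U (I : Type) (r : seq I) (P : pred I) (f : I -> V -> W) :
  open U -> (forall i, P i -> Ck_on k U (f i)) ->
  Ck_on k U (fun x => \sum_(i <- r | P i) f i x).
Proof.
move=> oU sf; elim: r => [|i r IH].
  by apply: eq_Ck_on (Ck_cst k U 0) => // x _; rewrite big_nil.
apply: (eq_Ck_on oU (f := fun x => (if P i then f i x else 0)
    + \sum_(j <- r | P j) f j x)) => [x _|].
  by rewrite big_cons; case: ifP; rewrite ?add0r.
apply: Ck_add => //; case Pi: (P i); [exact: sf|exact: Ck_cst].
Qed.

Lemma Ck_opp k U f : open U -> Ck_on k U f -> Ck_on k U (fun x => - f x).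
Proof.
move=> oU; elim: k f => [|k IH] f /=.
  by move=> cf x Ux; apply: cvgN; exact: cf.
move=> [df Df]; split=> [x Ux|v]; first by apply: differentiableN; exact: df.
apply: eq_Ck_on (IH _ (Df v)) => // x Ux.
by rewrite [RHS]deriveN//; apply: diff_derivable; exact: df.
Qed.

Lemma smooth_opp U f : open U -> smooth_on U f -> smooth_on U (fun x => - f x).
Proof. by move=> oU sf k; exact: Ck_opp. Qed.

Lemma smooth_sub U f g : open U -> smooth_on U f -> smooth_on U g ->
  smooth_on U (fun x => f x - g x).
Proof. by move=> oU sf sg; apply: smooth_add => //; exact: smooth_opp. Qed.

Lemma smooth_sum U (I : Type) (r : seq I) (P : pred I) (f : I -> V -> W) :
  open U -> (forall i, P i -> smooth_on U (f i)) ->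
  smooth_on U (fun x => \sum_(i <- r | P i) f i x).
Proof. by move=> oU sf k; apply: Ck_sum => // i Pi; exact: sf. Qed.

End Congruence.

Section ScalarFunctions.
Context {R : realType} {V : normedModType R}.
Variable U : set V.
Hypothesis oU : open U.
Implicit Types f g : V -> R.

Lemma Ck_mul k f g :
  Ck_on k U f -> Ck_on k U g -> Ck_on k U (fun x => f x * g x).
Proof.
elim: k f g => [|k IH] f g /=.
  by move=> cf cg x Ux; apply: cvgM; [exact: cf|exact: cg].
move=> [df Df] [dg Dg]; split=> [x Ux|v].
  by apply: differentiableM; [exact: df|exact: dg].
have cf : Ck_on k U f by apply: Ck_onS; split.
have cg : Ck_on k U g by apply: Ck_onS; split.
apply: eq_Ck_on (Ck_add oU (IH _ _ cf (Dg v)) (IH _ _ cg (Df v))) => // x Ux.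
by rewrite [RHS]deriveM//; apply: diff_derivable; [exact: df|exact: dg].
Qed.

Lemma smooth_mul f g : smooth_on U f -> smooth_on U g ->
  smooth_on U (fun x => f x * g x).
Proof. by move=> sf sg k; exact: Ck_mul. Qed.

Lemma Ck_inv k f : (forall x, U x -> f x != 0) ->
  Ck_on k U f -> Ck_on k U (fun x => (f x)^-1).
Proof.
move=> f0; elim: k => [|k IH] /=.
  by move=> cf x Ux; apply: cvgV; [exact: f0|exact: cf].
move=> [df Df]; split=> [x Ux|v].
  by apply: differentiableV; [exact: df|exact: f0].
have cV : Ck_on k U (fun x => (f x)^-1) by apply: IH; apply: Ck_onS; split.
have := Ck_mul (Ck_mul (Ck_cst k U (-1 : R)) (Ck_mul cV cV)) (Df v).
apply: eq_Ck_on => // x Ux.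
rewrite deriveV ?f0//; last exact/diff_derivable/df.
by rewrite mulN1r -invfM -expr2.
Qed.

Lemma smooth_inv f : (forall x, U x -> f x != 0) -> smooth_on U f ->
  smooth_on U (fun x => (f x)^-1).
Proof. by move=> f0 sf k; exact: Ck_inv. Qed.

Lemma smooth_prod (I : Type) (r : seq I) (P : pred I) (f : I -> V -> R) :
  (forall i, P i -> smooth_on U (f i)) ->
  smooth_on U (fun x => \prod_(i <- r | P i) f i x).
Proof.
move=> sf; elim: r => [|i r IH].
  by apply: smooth_eq (smooth_cst U (1 : R)) => // x _; rewrite big_nil.
apply: (smooth_eq oU (f := fun x => (if P i then f i x else 1)
    * \prod_(j <- r | P j) f j x)) => [x _|].
  by rewrite big_cons; case: ifP; rewrite ?mul1r.
apply: smooth_mul => //; case Pi: (P i); [exact: sf|exact: smooth_cst].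
Qed.

Lemma smooth_det n (A : V -> 'M[R]_n) :
  (forall i j, smooth_on U (fun x => A x i j)) ->
  smooth_on U (fun x => \det (A x)).
Proof.
move=> sA; apply: smooth_sum => // s _; apply: smooth_mul.
  exact: smooth_cst.
by apply: smooth_prod => i _; exact: sA.
Qed.

(** By Cramer's rule, the entries are cofactors divided by the determinant. *)
Lemma smooth_invmx n (A : V -> 'M[R]_n) :
  (forall i j, smooth_on U (fun x => A x i j)) ->
  (forall x, U x -> A x \in unitmx) ->
  forall i j, smooth_on U (fun x => invmx (A x) i j).
Proof.
move=> sA uA i j.
apply: (smooth_eq oU (f := fun x =>
  (\det (A x))^-1 * ((-1) ^+ (j + i) * \det (row' j (col' i (A x)))))).
  by move=> x Ux; rewrite /invmx uA// !mxE.
apply: smooth_mul; first apply: smooth_inv; last apply: smooth_mul.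
- by move=> x /uA; rewrite unitmxE unitfE.
- exact: smooth_det.
- exact: smooth_cst.
- apply: smooth_det => a b.
  apply: (smooth_eq oU (f := fun x => A x (lift j a) (lift i b))) => //.
  by move=> x _; rewrite !mxE.
Qed.

End ScalarFunctions.

(** * Coordinates and composition *)

Section RowFunctions.
Context {R : realType} {V : normedModType R} {n : nat}.
Implicit Types (F : V -> 'rV[R]_n) (U : set V).

Lemma row_differentiable F x :
  (forall j, differentiable (fun y => F y 0 j) x) -> differentiable F x.
Proof.
move=> dF.
have -> : F = \sum_j (fun y => F y 0 j *: (delta_mx 0 j : 'rV[R]_n)).
  by apply/funext => y; rewrite fct_sumE; exact: row_sum_delta.
by apply: differentiable_sum => j; exact: differentiableZl.
Qed.

Lemma differentiable_entry F x j :
  differentiable F x -> differentiable (fun y => F y 0 j) x.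
Proof.
move=> dF.
exact: (differentiable_comp dF (differentiable_coord (F x) 0 j)).
Qed.

Lemma derive_entry F x v j :
  differentiable F x -> ('D_v F x) 0 j = 'D_v (fun y => F y 0 j) x.
Proof. by move=> dF; rewrite derive_mx ?mxE//; exact: diff_derivable. Qed.

Lemma Ck_entry k U F j : open U ->
  Ck_on k U F -> Ck_on k U (fun x => F x 0 j).
Proof.
move=> oU; elim: k F => [|k IH] F /=.
  move=> cF x Ux.
  exact: (continuous_comp (cF x Ux) (@coord_continuous _ _ _ 0 j (F x))).
move=> [dF DF]; split=> [x /dF|v]; first exact: differentiable_entry.
apply: eq_Ck_on (IH _ (DF v)) => // x Ux.
by rewrite derive_entry//; exact: dF.
Qed.

Lemma row_Ck k U F : open U ->
  (forall j, Ck_on k U (fun x => F x 0 j)) -> Ck_on k U F.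
Proof.
move=> oU; elim: k F => [|k IH] F /= sF.
  apply: (@eq_Ck_on _ _ _ 0 _
      (fun y => \sum_j (F y 0 j *: (delta_mx 0 j : 'rV[R]_n)))) => //.
    by move=> x _; rewrite -row_sum_delta.
  apply: (@Ck_sum _ _ _ 0) => // j _ x Ux; apply: cvgZr_tmp; exact: sF.
have dF x : U x -> differentiable F x.
  by move=> Ux; apply: row_differentiable => j; exact: (sF j).1.
split=> // v; apply: IH => j.
by apply: eq_Ck_on ((sF j).2 v) => // x Ux; rewrite derive_entry//; exact: dF.
Qed.

Lemma smooth_row U F : open U ->
  (forall j, smooth_on U (fun x => F x 0 j)) -> smooth_on U F.
Proof. by move=> oU sF k; apply: row_Ck => // j; exact: sF. Qed.

Lemma smooth_entry U F j : open U ->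
  smooth_on U F -> smooth_on U (fun x => F x 0 j).
Proof. by move=> oU sF k; exact: Ck_entry. Qed.

End RowFunctions.

Section CoordinateDerivatives.
Context {R : realType} {n : nat} {W : normedModType R}.

Lemma derive_is_linear (f : 'rV[R]_n -> W) x a u v : differentiable f x ->
  'D_(a *: u + v) f x = a *: 'D_u f x + 'D_v f x.
Proof. by move=> df; rewrite !deriveE// linearP. Qed.

(** Reduces derivatives along a varying direction to partial derivatives, for
    which smoothness is already known. *)
Lemma derive_deltaE (f : 'rV[R]_n -> W) x v : differentiable f x ->
  'D_v f x = \sum_j v 0 j *: 'D_(delta_mx 0 j) f x.
Proof.
move=> df; rewrite deriveE// {1}[v]row_sum_delta linear_sum/=.
by apply: eq_bigr => j _; rewrite linearZ/= -deriveE.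
Qed.

End CoordinateDerivatives.

Section Composition.
Context {R : realType} {V : normedModType R} {n : nat}.
Variables (U : set V) (U' : set 'rV[R]_n).
Hypothesis oU : open U.

(** The derivative of [f \o F] is a sum of products of partial derivatives of
    [f] composed with [F] and of components of the derivative of [F], so that
    the induction on [k] applies to every factor. *)
Lemma Ck_comp k (f : 'rV[R]_n -> R) (F : V -> 'rV[R]_n) :
  (forall x, U x -> U' (F x)) ->
  Ck_on k U' f -> Ck_on k U F -> Ck_on k U (fun x => f (F x)).
Proof.
move=> FU; elim: k f => [|k IH] f.
  move=> /= cf cF x Ux; exact: (continuous_comp (cF x Ux) (cf _ (FU _ Ux))).
move=> [df Df] sF; have cF := Ck_onS sF; move: sF => [dF DF].
split=> [x Ux|v].
  by apply: (@differentiable_comp _ _ _ _ F f); [exact: dF|exact/df/FU].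
apply: (eq_Ck_on oU (f := fun x =>
    \sum_j ('D_v F x) 0 j * 'D_(delta_mx 0 j) f (F x))).
  move=> x Ux; have dfx := df _ (FU _ Ux); have dFx := dF _ Ux.
  rewrite -(derive_deltaE _ dfx) [RHS]deriveE; last exact: differentiable_comp.
  by rewrite (diff_comp dFx dfx) /= -deriveE// -deriveE.
apply: Ck_sum => // j _; apply: Ck_mul => //; last exact: (IH _ (Df _) cF).
exact: (Ck_entry j oU (DF v)).
Qed.

Lemma smooth_comp (f : 'rV[R]_n -> R) (F : V -> 'rV[R]_n) :
  (forall x, U x -> U' (F x)) -> smooth_on U' f -> smooth_on U F ->
  smooth_on U (fun x => f (F x)).
Proof. by move=> FU sf sF k; exact: Ck_comp. Qed.

End Composition.

Section DirectionalDerivative.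
Context {R : realType} {m n : nat}.
Variable U : set 'rV[R]_m.
Hypothesis oU : open U.

Lemma smooth_derive_along (F : 'rV[R]_m -> 'rV[R]_n)
    (X : 'rV[R]_m -> 'rV[R]_m) :
  smooth_on U F -> smooth_on U X -> smooth_on U (fun x => 'D_(X x) F x).
Proof.
move=> sF sX; apply: smooth_row => // k.
apply: (smooth_eq oU (f := fun x =>
    \sum_j X x 0 j * ('D_(delta_mx 0 j) F x) 0 k)).
  move=> x Ux; rewrite (derive_deltaE _ (smooth_differentiable sF Ux)) summxE.
  by apply: eq_bigr => j _; rewrite mxE.
apply: smooth_sum => // j _; apply: smooth_mul => //.
  exact: (smooth_entry j oU sX).
exact: (smooth_entry k oU (smooth_derive _ sF)).
Qed.

End DirectionalDerivative.

(** * Symmetry of second derivatives *)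

Section Schwarz.
Context {R : realType} {V : normedModType R}.
Implicit Types (f : V -> R) (x u v : V).

Lemma is_derive_line f x u (t : R) : differentiable f (t *: u + x) ->
  is_derive t 1 (fun s : R => f (s *: u + x)) ('D_u f (t *: u + x)).
Proof.
move=> df.
have dl : is_diff t (fun s : R => s *: u + x) ( *:%R^~ u).
  have := is_diffD (is_diff_scalel t u) (is_diff_cst x t).
  by rewrite addr0.
have dfl : differentiable (f \o (fun s : R => s *: u + x)) t.
  by apply: differentiable_comp.
apply: DeriveDef; first exact: diff_derivable.
have dl1 := @ex_diff _ _ _ _ _ _ _ dl.
rewrite [LHS]deriveE//.
have /= -> := congr1 (fun g => g 1) (diff_comp dl1 df).
by rewrite diff_val scale1r -deriveE.
Qed.

(** Two applications of the mean value theorem, along [u] to the increment of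
    [f] in the direction [v], then along [v] to its derivative. *)
Lemma second_difference f x u v (h : R) : 0 <= h ->
  (forall s t, s \in `[0, h] -> t \in `[0, h] ->
    differentiable f (s *: u + (t *: v + x)) /\
    differentiable (fun y => 'D_u f y) (s *: u + (t *: v + x))) ->
  exists s t, [/\ s \in `[0, h], t \in `[0, h] &
    f (h *: u + (h *: v + x)) - f (h *: v + x) - (f (h *: u + x) - f x)
    = 'D_v (fun y => 'D_u f y) (s *: u + (t *: v + x)) * h * h].
Proof.
move=> h0 df.
have I0 : (0 : R) \in `[0, h] by rewrite in_itv /= lexx.
have Ih : h \in `[0, h] by rewrite in_itv /= lexx h0.
have D1 (s : R) : s \in `[0, h] -> is_derive s 1
    (fun s : R => f (s *: u + (h *: v + x)) - f (s *: u + x))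
    ('D_u f (s *: u + (h *: v + x)) - 'D_u f (s *: u + x)).
  move=> Is; apply: is_deriveB; apply: is_derive_line.
    by have [] := df _ _ Is Ih.
  by have [] := df _ _ Is I0; rewrite scale0r add0r.
have [s Is Es] := MVT_segment h0 (fun s Is => D1 s (subset_itv_oo_cc Is))
  (derivable_within_continuous
    (fun s Is => @ex_derive _ _ _ _ _ _ _ (D1 s Is))).
have D2 (t : R) : t \in `[0, h] -> is_derive t 1
    (fun t : R => 'D_u f (t *: v + (s *: u + x)))
    ('D_v (fun y => 'D_u f y) (t *: v + (s *: u + x))).
  move=> It; apply: (@is_derive_line (fun y => 'D_u f y)).
  by have [_] := df _ _ Is It; rewrite addrCA.
have [t It Et] := MVT_segment h0 (fun s Is => D2 s (subset_itv_oo_cc Is))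
  (derivable_within_continuous
    (fun s Is => @ex_derive _ _ _ _ _ _ _ (D2 s Is))).
exists s, t; split=> //; move: Es Et; rewrite !scale0r !add0r !subr0.
rewrite [h *: v + (s *: u + x)]addrCA [s *: u + (t *: v + x)]addrCA.
by move=> Es Et; rewrite -Et -Es; ring.
Qed.

Lemma continuous_near_dist f x (e : R) : {for x, continuous f} -> 0 < e ->
  \forall y \near x, `|f x - f y| < e.
Proof. by move=> cf; move/cvgrPdist_lt : cf; exact. Qed.

(** The second difference of [f] on a small parallelogram is symmetric in the
    two sides, and it is [h ^+ 2] times a value of either mixed derivative at a
    nearby point; both derivatives being continuous, their values at [x]
    agree. *)
Lemma schwarz (U : set V) f x u v : open U -> Ck_on 2 U f -> U x ->
  'D_v (fun y => 'D_u f y) x = 'D_u (fun y => 'D_v f y) x.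
Proof.
move=> oU [df Df] Ux; apply/eqP; apply/negP => /negP neq.
set a : V -> R := fun y => 'D_v (fun y => 'D_u f y) y.
set b : V -> R := fun y => 'D_u (fun y => 'D_v f y) y.
have ca : {for x, continuous a} by exact: (Df u).2.
have cb : {for x, continuous b} by exact: (Df v).2.
pose e := `|a x - b x| / 2.
have e0 : 0 < e by rewrite divr_gt0// normr_gt0 subr_eq0.
have nU : \forall y \near x, U y by exact: open_nbhs_nbhs.
have na : \forall y \near x, `|a x - a y| < e.
  exact: continuous_near_dist.
have nb : \forall y \near x, `|b x - b y| < e.
  exact: continuous_near_dist.
have near_x : nbhs x (fun y => U y /\ (`|a x - a y| < e /\ `|b x - b y| < e)).
  exact: filterI nU (filterI na nb).
have /nbhs_ballP[d /= d0 bd] := near_x.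
(* Any parallelogram of side [h] at [x] stays in the ball of radius [d]. *)
pose h := d / 2 / (`|u| + `|v| + 1).
have k0 : 0 < `|u| + `|v| + 1 by rewrite ltr_pwDr// addr_ge0.
have h0 : 0 < h by rewrite !divr_gt0.
have hd : h * (`|u| + `|v| + 1) < d.
  by rewrite /h divfK ?gt_eqF// ltr_pdivrMr// mulr_natr mulr2n ltrDl.
have inb s t : s \in `[0, h] -> t \in `[0, h] ->
    ball x d (s *: u + (t *: v + x)).
  rewrite !in_itv /= => /andP[s0 sh] /andP[t0 th].
  rewrite -ball_normE /= addrA opprD addrCA subrr addr0 normrN.
  apply: le_lt_trans hd; apply: le_trans (ler_normD _ _) _.
  rewrite !normrZ !ger0_norm// !mulrDr -[leLHS]addr0.
  by rewrite !lerD ?ler_wpM2r// mulr1 ltW.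
have [s [t [Is It E1]]] : exists s t, [/\ s \in `[0, h], t \in `[0, h] &
    f (h *: u + (h *: v + x)) - f (h *: v + x) - (f (h *: u + x) - f x)
    = a (s *: u + (t *: v + x)) * h * h].
  apply: second_difference; first exact: ltW.
  move=> s t Is It; have [Uy _] := bd _ (inb _ _ Is It).
  by split; [exact: df|exact: (Df u).1].
have [s' [t' [Is' It' E2]]] : exists s t, [/\ s \in `[0, h], t \in `[0, h] &
    f (h *: v + (h *: u + x)) - f (h *: u + x) - (f (h *: v + x) - f x)
    = b (s *: v + (t *: u + x)) * h * h].
  apply: second_difference; first exact: ltW.
  move=> s' t' Is' It'; have [Uy _] := bd _ (inb _ _ It' Is').
  rewrite addrCA in Uy.
  by split; [exact: df|exact: (Df v).1].
have abx : `|a x - b x| = e + e by rewrite /e -splitr.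
(* The rest concerns only values of [a] and [b] at [x] and at two points. *)
clearbody a b e; clear neq.
have [_ [A _]] := bd _ (inb _ _ Is It).
have [_ [_ B]] := bd _ (inb _ _ It' Is'); rewrite addrCA in B.
have AB : a (s *: u + (t *: v + x)) = b (s' *: v + (t' *: u + x)).
  apply: (mulIf (lt0r_neq0 h0)); apply: (mulIf (lt0r_neq0 h0)).
  rewrite -E1 -E2 [h *: u + (h *: v + x)]addrCA.
  move: (f _) (f (h *: v + x)) (f (h *: u + x)) (f x) => p q r z; ring.
have : `|a x - b x| < e + e.
  rewrite -(subrKA (a (s *: u + (t *: v + x))) (a x)) [X in _ + (X - _)]AB.
  by rewrite (le_lt_trans (ler_normD _ _))// ltrD// distrC.
by rewrite abx ltxx.
Qed.

End Schwarz.

(** * The Koszul formula in coordinates *)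

Section BilinearForm.
Context {R : realType} {n : nat}.
Implicit Types (A : 'M[R]_n) (u v w : 'rV[R]_n).

Lemma bformE A u v : bform A u v = \sum_i \sum_j u 0 i * A i j * v 0 j.
Proof.
rewrite /bform mxE exchange_big; apply: eq_bigr => j _.
by rewrite !mxE mulr_suml.
Qed.

Lemma bformDl A u u' v : bform A (u + u') v = bform A u v + bform A u' v.
Proof. by rewrite /bform !mulmxDl mxE. Qed.

Lemma bformDr A u v v' : bform A u (v + v') = bform A u v + bform A u v'.
Proof. by rewrite /bform linearD /= mulmxDr mxE. Qed.

Lemma bformZl A a u v : bform A (a *: u) v = a * bform A u v.
Proof. by rewrite /bform -!scalemxAl mxE. Qed.

Lemma bformZr A a u v : bform A u (a *: v) = a * bform A u v.
Proof. by rewrite /bform linearZ /= -scalemxAr mxE. Qed.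

Lemma bform0l A v : bform A 0 v = 0.
Proof. by rewrite /bform !mul0mx mxE. Qed.

Lemma bformNl A u v : bform A (- u) v = - bform A u v.
Proof. by rewrite -scaleN1r bformZl mulN1r. Qed.

Lemma bformBl A u u' v : bform A (u - u') v = bform A u v - bform A u' v.
Proof. by rewrite bformDl bformNl. Qed.

Lemma bform_suml A (I : Type) (r : seq I) (P : pred I) (f : I -> 'rV[R]_n) v :
  bform A (\sum_(i <- r | P i) f i) v = \sum_(i <- r | P i) bform A (f i) v.
Proof.
by apply: (big_morph (bform A ^~ v)) => [a b|]; rewrite ?bformDl ?bform0l.
Qed.

Lemma bformC A u v : A^T = A -> bform A u v = bform A v u.
Proof.
move=> symA; have -> : bform A u v = (u *m A *m v^T)^T 0 0 by rewrite mxE.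
by rewrite !trmx_mul trmxK symA mulmxA.
Qed.

Lemma bform_delta A i j : bform A (delta_mx 0 i) (delta_mx 0 j) = A i j.
Proof. by rewrite /bform -rowE trmx_delta -colE !mxE. Qed.

Lemma posdef_unitmx A : (forall u, u != 0 -> 0 < bform A u u) -> A \in unitmx.
Proof.
move=> posA; rewrite -row_free_unit -kermx_eq0; apply/eqP/row_matrixP => i.
rewrite row0; apply/eqP; apply/negPn/negP => /posA.
by rewrite /bform -row_mul mulmx_ker row0 mul0mx mxE ltxx.
Qed.

Lemma bform_mul_invmx A r w : A \in unitmx ->
  bform A (r *m invmx A) w = \sum_l w 0 l * r 0 l.
Proof.
move=> uA; rewrite /bform mulmxKV// mxE.
by apply: eq_bigr => l _; rewrite mxE mulrC.
Qed.

Lemma linear_deltaE (W : lmodType R) (f : 'rV[R]_n -> W) u :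
  linear f -> f u = \sum_i u 0 i *: f (delta_mx 0 i).
Proof.
move=> lf; pose fM := GRing.isLinear.Build _ _ _ _ f lf.
pose fL : {linear 'rV[R]_n -> W} := HB.pack f fM.
rewrite -[f]/(fL : _ -> _) {1}[u]row_sum_delta linear_sum.
by apply: eq_bigr => i _; rewrite linearZ.
Qed.

Lemma linear_form_deltaE (f : 'rV[R]_n -> R) u :
  (forall a v w, f (a *: v + w) = a * f v + f w) ->
  f u = \sum_i u 0 i * f (delta_mx 0 i).
Proof. exact: (@linear_deltaE R^o). Qed.

Lemma bform_deltar A u w :
  bform A u w = \sum_l w 0 l * bform A u (delta_mx 0 l).
Proof.
apply: (@linear_form_deltaE (fun w => bform A u w)) => a b b'.
by rewrite bformDr bformZr.
Qed.

Lemma bform_deltal A u w :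
  bform A u w = \sum_l u 0 l * bform A (delta_mx 0 l) w.
Proof.
apply: (@linear_form_deltaE (fun u => bform A u w)) => a b b'.
by rewrite bformDl bformZl.
Qed.

End BilinearForm.

(** The derivative of the metric at [y] in the direction [a].  It is sealed:
    deciding whether two of them are convertible would compare limits. *)
HB.lock Definition dgram (R : realType) n (K : 'rV[R]_n -> 'M[R]_n)
  (y a : 'rV[R]_n) : 'M[R]_n := \matrix_(i, j) 'D_a (fun z => K z i j) y.

Section MetricDerivative.
Context {R : realType} {n : nat}.
Variable K : 'rV[R]_n -> 'M[R]_n.

Local Notation dgram := (dgram K).

Lemma dgramE y a i j : dgram y a i j = 'D_a (fun z => K z i j) y.
Proof. by rewrite unlock mxE. Qed.

Lemma dgram_deltaE y a u v :
  (forall i j, differentiable (fun z => K z i j) y) ->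
  bform (dgram y a) u v = \sum_l a 0 l * bform (dgram y (delta_mx 0 l)) u v.
Proof.
move=> dK; apply: (@linear_form_deltaE _ _ (fun a => bform (dgram y a) u v)).
move=> c b b'; rewrite !bformE.
rewrite mulr_sumr -big_split; apply: eq_bigr => i _ /=.
rewrite mulr_sumr -big_split; apply: eq_bigr => j _ /=.
rewrite !dgramE derive_is_linear//; rewrite -[_ *: 'D_b _ _]/(_ * _); ring.
Qed.

Lemma Gamma_linearl y v : linear (fun u => Gamma K y u v).
Proof.
move=> c a b; apply/rowP => k; rewrite !mxE mulr_sumr -big_split.
apply: eq_bigr => i _ /=; rewrite mulr_sumr -big_split.
apply: eq_bigr => j _ /=.
by rewrite !mxE; ring.
Qed.

Lemma Gamma0r y u : Gamma K y u 0 = 0.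
Proof.
apply/rowP => k; rewrite !mxE big1// => i _; rewrite big1// => j _.
by rewrite mxE mulr0.
Qed.

(** The definition of the Christoffel symbols, with the sums over the two lower
    indices carried out: the index raised by [invmx] is the remaining one. *)
Lemma GammaE y u v : (forall i j, differentiable (fun z => K z i j) y) ->
  Gamma K y u v = 2^-1 *: ((\row_l (bform (dgram y u) v (delta_mx 0 l)
    + bform (dgram y v) u (delta_mx 0 l)
    - bform (dgram y (delta_mx 0 l)) u v)) *m invmx (K y)).
Proof.
move=> dK; apply/rowP => k; rewrite !mxE.
transitivity (2^-1 * \sum_l (\sum_i \sum_j (partial i (fun z => K z j l) y
   + partial j (fun z => K z i l) y - partial l (fun z => K z i j) y)
     * u 0 i * v 0 j) * invmx (K y) l k).
  rewrite [RHS]mulr_sumr [RHS](eq_bigr (fun l => \sum_i \sum_j 2^-1 *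
    ((partial i (fun z => K z j l) y + partial j (fun z => K z i l) y
     - partial l (fun z => K z i j) y) * u 0 i * v 0 j * invmx (K y) l k))).
    rewrite [RHS]exchange_big /=; apply: eq_bigr => i _.
    rewrite [RHS]exchange_big /=; apply: eq_bigr => j _.
    rewrite /christoffel mulr_sumr !mulr_suml; apply: eq_bigr => l _; ring.
  move=> l _; rewrite mulr_suml mulr_sumr; apply: eq_bigr => i _.
  by rewrite mulr_suml mulr_sumr.
congr (_ * _); apply: eq_bigr => l _; congr (_ * _); rewrite mxE.
rewrite (dgram_deltaE u)// (dgram_deltaE v)//.
under [X in _ = X + _ - _]eq_bigr do rewrite bform_deltal mulr_sumr.
under [X in _ = _ + X - _]eq_bigr do rewrite bform_deltal mulr_sumr.
rewrite [X in _ + X - _]exchange_big bformE -big_split -sumrB /=.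
apply: eq_bigr => i _; rewrite -big_split -sumrB /=; apply: eq_bigr => j _.
by rewrite !bform_delta !dgramE /partial; ring.
Qed.

(** Koszul's formula; lowering the index cancels [invmx]. *)
Lemma koszul y u v w : (forall i j, differentiable (fun z => K z i j) y) ->
  K y \in unitmx ->
  bform (K y) (Gamma K y u v) w = 2^-1 * (bform (dgram y u) v w
    + bform (dgram y v) u w - bform (dgram y w) u v).
Proof.
move=> dK uK; rewrite GammaE// bformZl bform_mul_invmx//; congr (_ * _).
rewrite (dgram_deltaE w)// (bform_deltar _ v w) (bform_deltar _ u w).
rewrite -big_split -sumrB /=.
by apply: eq_bigr => l _; rewrite mxE; ring.
Qed.

End MetricDerivative.

(** * Metric compatibility along a map *)

(** The local content of a Riemannian metric: a Gram field on an open set. *)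
Record smooth_metric (R : realType) n (V : set 'rV[R]_n)
    (K : 'rV[R]_n -> 'M[R]_n) : Prop := SmoothMetric {
  metric_smooth : forall i j, smooth_on V (fun y => K y i j);
  metric_sym : forall y, V y -> (K y)^T = K y;
  metric_pos : forall y, V y -> forall u, u != 0 -> 0 < bform (K y) u u
}.

Section SmoothMetric.
Context {R : realType} {n : nat}.
Variables (V : set 'rV[R]_n) (K : 'rV[R]_n -> 'M[R]_n).
Hypotheses (oV : open V) (mK : smooth_metric V K).

Lemma metric_differentiable y i j :
  V y -> differentiable (fun z => K z i j) y.
Proof.
by move=> Vy; exact: (smooth_differentiable (metric_smooth mK i j) Vy).
Qed.

Lemma metric_unitmx y : V y -> K y \in unitmx.
Proof. by move=> Vy; apply: posdef_unitmx => u; exact: (metric_pos mK). Qed.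

Lemma metricC y u v : V y -> bform (K y) u v = bform (K y) v u.
Proof. by move=> Vy; apply: bformC; exact: (metric_sym mK). Qed.

Lemma dgramC y a u v : V y -> bform (dgram K y a) u v = bform (dgram K y a) v u.
Proof.
move=> Vy; apply: bformC; apply/matrixP => i j; rewrite mxE !dgramE.
apply: (eq_on_derive _ oV) => // z Vz.
by rewrite -[in RHS](metric_sym mK Vz) mxE.
Qed.

Lemma metric_koszul y u v w : V y ->
  bform (K y) (Gamma K y u v) w = 2^-1 * (bform (dgram K y u) v w
    + bform (dgram K y v) u w - bform (dgram K y w) u v).
Proof.
move=> Vy; apply: koszul; last exact: metric_unitmx.
by move=> i j; exact: metric_differentiable.
Qed.

(** Parallelism of the metric: in the sum of the two Koszul formulas the terms
    that differentiate along [u] and [v] cancel. *)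
Lemma dgram_Gamma y a u v : V y ->
  bform (dgram K y a) u v
  = bform (K y) (Gamma K y a u) v + bform (K y) u (Gamma K y a v).
Proof.
move=> Vy; rewrite [X in _ + X]metricC// !metric_koszul//.
rewrite (dgramC _ v u)// (dgramC u a v)// (dgramC v a u)//; lra.
Qed.

Lemma Gamma_sym y u v : V y -> Gamma K y u v = Gamma K y v u.
Proof.
move=> Vy; have dK i j := metric_differentiable i j Vy.
rewrite !GammaE//; congr (_ *: (_ *m _)); apply/rowP => l; rewrite !mxE.
by rewrite (dgramC _ u v)//; congr (_ - _); rewrite addrC.
Qed.

Lemma smooth_christoffel i j k : smooth_on V (fun y => christoffel K y i j k).
Proof.
apply: smooth_mul => //; first exact: smooth_cst.
have sK a b c : smooth_on V (fun y => partial a (fun z => K z b c) y).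
  exact: (smooth_derive _ (metric_smooth mK b c)).
apply: smooth_sum => // l _; apply: smooth_mul => //.
  apply: smooth_sub => //; apply: smooth_add => //; exact: sK.
apply: smooth_invmx => //; first exact: metric_smooth.
by move=> y Vy; exact: metric_unitmx.
Qed.

End SmoothMetric.

Section AlongMap.
Context {R : realType} {m n : nat}.
Variables (K : 'rV[R]_n -> 'M[R]_n) (F : 'rV[R]_m -> 'rV[R]_n).
Implicit Types xi zeta : 'rV[R]_m -> 'rV[R]_n.

(** The product rule, for the metric evaluated along the map. *)
Lemma derive_bform x v xi zeta :
  differentiable F x -> (forall i j, differentiable (fun y => K y i j) (F x)) ->
  differentiable xi x -> differentiable zeta x ->
  'D_v (fun y => bform (K (F y)) (xi y) (zeta y)) x
  = bform (dgram K (F x) ('d F x v)) (xi x) (zeta x)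
    + bform (K (F x)) ('D_v xi x) (zeta x)
    + bform (K (F x)) (xi x) ('D_v zeta x).
Proof.
move=> dF dK dxi dz.
have dKF i j : is_derive x v (fun y => K (F y) i j)
    (dgram K (F x) ('d F x v) i j).
  have dc : differentiable ((fun y => K y i j) \o F) x.
    exact: differentiable_comp.
  apply: DeriveDef; first exact: diff_derivable.
  rewrite dgramE [LHS]deriveE// deriveE//.
  by have /= -> := congr1 (fun g => g v) (diff_comp dF (dK i j)).
have dx i : is_derive x v (fun y => xi y 0 i) ('D_v xi x 0 i).
  rewrite derive_entry//.
  exact/derivableP/diff_derivable/differentiable_entry.
have dzx i : is_derive x v (fun y => zeta y 0 i) ('D_v zeta x 0 i).
  rewrite derive_entry//.
  exact/derivableP/diff_derivable/differentiable_entry.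
have -> : (fun y => bform (K (F y)) (xi y) (zeta y)) =
    \sum_i \sum_j ((fun y => xi y 0 i) * (fun y => K (F y) i j)
                   * (fun y => zeta y 0 j)).
  apply/funext => y; rewrite bformE fct_sumE; apply: eq_bigr => i _.
  by rewrite fct_sumE.
rewrite derive_val !bformE -!big_split; apply: eq_bigr => i _ /=.
rewrite -!big_split; apply: eq_bigr => j _ /=.
rewrite -![_ *: _]/(_ * _) !fctE /=; ring.
Qed.

Lemma smooth_Gamma (U : set 'rV[R]_m) xi zeta : open U ->
  (forall i j k, smooth_on U (fun x => christoffel K (F x) i j k)) ->
  smooth_on U xi -> smooth_on U zeta ->
  smooth_on U (fun x => Gamma K (F x) (xi x) (zeta x)).
Proof.
move=> oU sC sxi sz; apply: smooth_row => // k.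
apply: (smooth_eq oU (f := fun x => \sum_i \sum_j
    christoffel K (F x) i j k * xi x 0 i * zeta x 0 j)).
  by move=> x _; rewrite mxE.
apply: smooth_sum => // i _; apply: smooth_sum => // j _.
apply: smooth_mul => //; last exact: (smooth_entry j oU sz).
apply: smooth_mul => //; exact: (smooth_entry i oU sxi).
Qed.

Lemma smooth_bform (U : set 'rV[R]_m) xi zeta : open U ->
  (forall i j, smooth_on U (fun x => K (F x) i j)) ->
  smooth_on U xi -> smooth_on U zeta ->
  smooth_on U (fun x => bform (K (F x)) (xi x) (zeta x)).
Proof.
move=> oU sK sxi sz; apply: (smooth_eq oU (f := fun x => \sum_i \sum_j
    xi x 0 i * K (F x) i j * zeta x 0 j)).
  by move=> x _; rewrite bformE.
apply: smooth_sum => // i _; apply: smooth_sum => // j _.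
apply: smooth_mul => //; last exact: (smooth_entry j oU sz).
apply: smooth_mul => //; exact: (smooth_entry i oU sxi).
Qed.

End AlongMap.

Section MetricCompatibility.
Context {R : realType} {m n : nat}.
Variable V : set 'rV[R]_n.
Variables (K : 'rV[R]_n -> 'M[R]_n) (F : 'rV[R]_m -> 'rV[R]_n).
Hypotheses (oV : open V) (mK : smooth_metric V K).

(** The Christoffel terms of the two derivatives add up to the derivative of the
    metric along the map. *)
Lemma metric_compat X xi zeta x : V (F x) -> differentiable F x ->
  differentiable xi x -> differentiable zeta x ->
  'D_(X x) (fun y => bform (K (F y)) (xi y) (zeta y)) x
  = bform (K (F x)) (nabla_along K F X xi x) (zeta x)
    + bform (K (F x)) (xi x) (nabla_along K F X zeta x).
Proof.
move=> VFx dF dxi dz; rewrite derive_bform//; last first.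
  by move=> i j; exact: (metric_differentiable mK).
rewrite (dgram_Gamma oV mK)// /nabla_along bformDl bformDr; ring.
Qed.

End MetricCompatibility.

(** * The Gauss formula *)

Section IsometricImmersion.
Context {R : realType} {m n : nat}.
Variables (U : set 'rV[R]_m) (V : set 'rV[R]_n).
Variables (G : 'rV[R]_m -> 'M[R]_m) (K : 'rV[R]_n -> 'M[R]_n).
Variable F : 'rV[R]_m -> 'rV[R]_n.
Hypotheses (oU : open U) (oV : open V).
Hypotheses (mG : smooth_metric U G) (mK : smooth_metric V K).
Hypotheses (sF : smooth_on U F) (FU : forall x, U x -> V (F x)).
Hypothesis isoF : forall x, U x -> forall u v,
  bform (G x) u v = bform (K (F x)) ('d F x u) ('d F x v).

Implicit Types (X Y : 'rV[R]_m -> 'rV[R]_m) (xi zeta : 'rV[R]_m -> 'rV[R]_n).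

Let dF x : U x -> differentiable F x.
Proof. exact: smooth_differentiable. Qed.

Lemma smooth_push X : smooth_on U X -> smooth_on U (push F X).
Proof.
move=> sX; apply: smooth_eq (smooth_derive_along oU sF sX) => // x Ux.
by rewrite deriveE//; exact: dF.
Qed.

Lemma push_differentiable u x : U x -> differentiable (push F (cst u)) x.
Proof.
move=> Ux; apply: smooth_differentiable Ux; apply: smooth_push.
exact: smooth_cst.
Qed.

Lemma smooth_nabla_along X xi : smooth_on U X -> smooth_on U xi ->
  smooth_on U (nabla_along K F X xi).
Proof.
move=> sX sxi; apply: smooth_add => //; first exact: smooth_derive_along.
apply: smooth_Gamma => //; last exact: smooth_push.
by move=> i j k; exact: (smooth_comp oU FU (smooth_christoffel oV mK i j k) sF).
Qed.

Lemma smooth_nabla X Y : smooth_on U X -> smooth_on U Y ->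
  smooth_on U (nabla G X Y).
Proof.
move=> sX sY; apply: smooth_add => //; first exact: smooth_derive_along.
apply: (smooth_Gamma (F := id)) => // i j k.
exact: (smooth_christoffel oU mG i j k).
Qed.

(** Absence of torsion: both the second derivative of [F] and the Christoffel
    symbols are symmetric. *)
Lemma nabla_along_push_sym x u v : U x ->
  nabla_along K F (cst u) (push F (cst v)) x
  = nabla_along K F (cst v) (push F (cst u)) x.
Proof.
move=> Ux; rewrite /nabla_along (Gamma_sym oV mK _ _ (FU Ux)); congr (_ + _).
have swap a b k : ('D_a (push F (cst b)) x) 0 k
    = 'D_a (fun y => 'D_b (fun z => F z 0 k) y) x.
  rewrite derive_entry; last exact: push_differentiable.
  apply: (eq_on_derive _ oU) Ux => y Uy.
  by rewrite -derive_entry ?deriveE//; exact: dF.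
apply/rowP => k; rewrite !swap.
exact: (schwarz v u oU (smooth_entry k oU sF 2%N) Ux).
Qed.

(** The tangential part of the connection of the target is the Levi-Civita
    connection of the source.  With [T a b c] the left-hand side, metric
    compatibility reads [dgram a b c = T a b c + T a c b]; since [T] is
    symmetric in its first two arguments, Koszul's formula solves this for
    [T]. *)
Lemma nabla_along_push_tangent x u v w : U x ->
  bform (K (F x)) (nabla_along K F (cst u) (push F (cst v)) x) ('d F x w)
  = bform (G x) (Gamma G x u v) w.
Proof.
move=> Ux.
pose T a b c :=
  bform (K (F x)) (nabla_along K F (cst a) (push F (cst b)) x) ('d F x c).
have Tsym a b c : T a b c = T b a c by rewrite /T nabla_along_push_sym.
have dG a b c : bform (dgram G x a) b c = T a b c + T a c b.
  have <- : 'D_a (fun y => bform (G y) b c) x = bform (dgram G x a) b c.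
    rewrite (@derive_bform _ _ _ G id x a (cst b) (cst c))//; last first.
      by move=> i j; exact: (metric_differentiable mG).
    rewrite diff_val !derive_cst bform0l (bformC _ _ (metric_sym mG Ux)).
    by rewrite bform0l !addr0.
  rewrite (eq_on_derive _ oU (g := fun y =>
    bform (K (F y)) (push F (cst b) y) (push F (cst c) y)) _ Ux); last first.
    by move=> y Uy; rewrite isoF.
  rewrite (metric_compat oV mK (cst a) (FU Ux)); first last.
  - exact: push_differentiable.
  - exact: push_differentiable.
  - exact: dF.
  by congr (_ + _); rewrite (metricC mK _ _ (FU Ux)).
rewrite (metric_koszul mG)// !dG -/(T u v w) (Tsym v u w) (Tsym w u v).
rewrite (Tsym w v u); lra.
Qed.

Lemma second_form_cst_normal x u v w : U x ->
  bform (K (F x)) (second_form G K F (cst u) (cst v) x) ('d F x w) = 0.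
Proof.
move=> Ux; rewrite /second_form bformBl nabla_along_push_tangent//.
by rewrite -isoF// /nabla derive_cst add0r subrr.
Qed.

Lemma second_form_cst_sym x u v : U x ->
  second_form G K F (cst u) (cst v) x = second_form G K F (cst v) (cst u) x.
Proof.
move=> Ux; rewrite /second_form nabla_along_push_sym//; congr (_ - 'd F x _).
by rewrite /nabla !derive_cst !add0r (Gamma_sym oU mG).
Qed.

Lemma second_form_cst_linear x v : U x ->
  linear (fun u => second_form G K F (cst u) (cst v) x).
Proof.
move=> Ux a b c; rewrite /second_form /nabla_along /nabla !derive_cst !add0r.
have dFZ : 'd F x (a *: b + c) = a *: 'd F x b + 'd F x c by rewrite linearP.
rewrite /= (derive_is_linear _ _ _ (push_differentiable v Ux)).
rewrite dFZ !Gamma_linearl linearP /=.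
by rewrite [X in X - _]addrACA opprD [LHS]addrACA 2!scalerDr scalerN.
Qed.

(** In coordinates [push F Y] is the sum of the components of [Y] times the
    partial derivatives of [F]; the product rule separates the two kinds of
    factors. *)
Lemma derive_push x v Y : U x -> differentiable Y x ->
  'D_v (push F Y) x = 'D_v (push F (cst (Y x))) x + 'd F x ('D_v Y x).
Proof.
move=> Ux dY.
have dDF j : differentiable (fun y => 'D_(delta_mx 0 j) F y) x.
  exact: (smooth_differentiable (smooth_derive _ sF) Ux).
have pushE Z k : differentiable Z x -> ('D_v (push F Z) x) 0 k =
    \sum_j (Z x 0 j * 'D_v (fun y => ('D_(delta_mx 0 j) F y) 0 k) x
            + ('D_(delta_mx 0 j) F x) 0 k * 'D_v Z x 0 j).
  move=> dZ.
  have near_push : \near x, \sum_j (Z x 0 j *: 'D_(delta_mx 0 j) F x)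
      = push F Z x.
    apply: (near_in_open oU Ux) => y Uy.
    by rewrite /push -deriveE ?derive_deltaE//; exact: dF.
  have dZj j := differentiable_entry j dZ.
  have dDFj j := differentiable_entry k (dDF j).
  have i1 j : is_derive x v (fun y => Z y 0 j) ('D_v Z x 0 j).
    by rewrite derive_entry//; exact/derivableP/diff_derivable.
  have i2 j : is_derive x v (fun y => ('D_(delta_mx 0 j) F y) 0 k)
      ('D_v (fun y => ('D_(delta_mx 0 j) F y) 0 k) x).
    exact/derivableP/diff_derivable.
  rewrite -(near_eq_derive _ near_push) derive_entry; last first.
    apply: row_differentiable => l.
    have -> : (fun y => (\sum_j Z y 0 j *: 'D_(delta_mx 0 j) F y) 0 l) =
      \sum_j ((fun y => Z y 0 j) * (fun y => ('D_(delta_mx 0 j) F y) 0 l)).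
      apply/funext => y; rewrite summxE fct_sumE; apply: eq_bigr => j _.
      by rewrite mxE.
    apply: differentiable_sum => j; apply: differentiableM => //.
    exact: differentiable_entry.
  have -> : (fun y => (\sum_j Z y 0 j *: 'D_(delta_mx 0 j) F y) 0 k) =
    \sum_j ((fun y => Z y 0 j) * (fun y => ('D_(delta_mx 0 j) F y) 0 k)).
    apply/funext => y; rewrite summxE fct_sumE; apply: eq_bigr => j _.
    by rewrite mxE.
  by rewrite derive_val.
apply/rowP => k; rewrite mxE (pushE Y k dY).
rewrite (pushE (cst (Y x)) k (differentiable_cst _ _)).
have -> : 'd F x ('D_v Y x) = 'D_('D_v Y x) F x by rewrite (deriveE _ (dF Ux)).
rewrite (derive_deltaE _ (dF Ux)) summxE -big_split /=.
apply: eq_bigr => j _; rewrite derive_cst !mxE mulr0 addr0.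
by rewrite [X in _ + X]mulrC.
Qed.

(** Tensoriality: the derivative of [Y] cancels, so that only the values of the
    two fields at [x] matter. *)
Lemma second_formE x X Y : U x -> differentiable Y x ->
  second_form G K F X Y x = second_form G K F (cst (X x)) (cst (Y x)) x.
Proof.
move=> Ux dY; rewrite /second_form /nabla_along /nabla derive_cst add0r /=.
rewrite derive_push// linearD /= /push.
by rewrite [X in X - _]addrAC opprD addrA addrK.
Qed.

End IsometricImmersion.

(** * The second fundamental form of an umbilical submanifold *)

Section UmbilicalSubmanifold.
Context {R : realType} {m n : nat}.
Variables (U : set 'rV[R]_m) (V : set 'rV[R]_n).
Variables (G : 'rV[R]_m -> 'M[R]_m) (K : 'rV[R]_n -> 'M[R]_n).
Variable F : 'rV[R]_m -> 'rV[R]_n.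
Variable e : 'I_m -> 'rV[R]_m -> 'rV[R]_m.
Hypotheses (m_gt0 : (0 < m)%N) (oU : open U) (oV : open V).
Hypotheses (mG : smooth_metric U G) (mK : smooth_metric V K).
Hypotheses (sF : smooth_on U F) (FU : forall x, U x -> V (F x)).
Hypothesis isoF : forall x, U x -> forall u v,
  bform (G x) u v = bform (K (F x)) ('d F x u) ('d F x v).
Hypothesis frame_e : orthonormal_frame G U e.
Hypothesis umbilical : forall x, U x -> forall eta, unit_normal K F x eta ->
  exists lam : R, shape_operator G K F x eta = lam%:M.

Local Notation tau := (tension G K F e).
Local Notation c := (m%:R^-1 : R).

Local Notation h x := (bform (K (F x))).

Let mc1 : m%:R * c = 1 :> R.
Proof. by rewrite divff// pnatr_eq0 -lt0n. Qed.

Let dF x : U x -> differentiable F x.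
Proof. exact: smooth_differentiable. Qed.

Let se i : smooth_on U (e i). Proof. exact: frame_e.1. Qed.

Let de i x : U x -> differentiable (e i) x.
Proof. exact: smooth_differentiable. Qed.

Lemma tensionE x : U x ->
  tau x = \sum_i second_form G K F (cst (e i x)) (cst (e i x)) x.
Proof.
move=> Ux; apply: eq_bigr => i _.
by rewrite (second_formE G K oU sF _ Ux)//; exact: de.
Qed.

Lemma tension_normal x w : U x -> h x (tau x) ('d F x w) = 0.
Proof.
move=> Ux; rewrite tensionE// bform_suml big1// => i _.
exact: (second_form_cst_normal oU oV mG mK sF FU isoF).
Qed.

Lemma smooth_tension : smooth_on U tau.
Proof.
apply: smooth_sum => // i _; apply: smooth_sub => //.
  by apply: (smooth_nabla_along oU oV mK sF FU) => //; exact: smooth_push.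
by apply: (smooth_push oU sF (X := nabla G (e i) (e i))); exact: smooth_nabla.
Qed.

(** The shape operator is defined by its entries in the coordinate basis; the
    identity extends to all vectors by bilinearity of [B]. *)
Lemma shape_scalarE x eta lam u v : U x ->
  shape_operator G K F x eta = lam%:M ->
  h x (second_form G K F (cst u) (cst v) x) eta = lam * bform (G x) u v.
Proof.
move=> Ux /(congr1 (mulmx^~ (G x))) /=; rewrite /shape_operator.
rewrite mulmxKV ?(metric_unitmx mG)// mul_scalar_mx => /matrixP S.
rewrite [LHS](@linear_form_deltaE _ _
  (fun u => h x (second_form G K F (cst u) (cst v) x) eta)); last first.
  move=> a b b'; rewrite (second_form_cst_linear G K oU sF v Ux).
  by rewrite bformDl bformZl.
rewrite bform_deltal mulr_sumr; apply: eq_bigr => i _.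
rewrite mulrCA; congr (_ * _).
rewrite [LHS](@linear_form_deltaE _ _
  (fun v => h x (second_form G K F (cst (delta_mx 0 i)) (cst v) x) eta));
  last first.
  move=> a b b'.
  have sym := second_form_cst_sym oU oV mG mK sF FU (delta_mx 0 i) _ Ux.
  rewrite (sym (a *: b + b')) (sym b) (sym b').
  by rewrite (second_form_cst_linear G K oU sF _ Ux) bformDl bformZl.
rewrite bform_deltar mulr_sumr; apply: eq_bigr => j _.
by rewrite mulrCA bform_delta; have := S i j; rewrite !mxE => ->.
Qed.

(** The difference [w] of the two sides is normal.  Were it nonzero, it could be
    scaled to a unit normal [eta]; if [lam] is the principal curvature with
    respect to [eta], then [B(u, v)] pairs with [eta] to [lam * g(u, v)] and
    [tau] to [m * lam], so that [w] is orthogonal to [eta], hence to itself. *)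
Lemma umbilical_second_form x u v : U x ->
  second_form G K F (cst u) (cst v) x = bform (G x) u v *: (c *: tau x).
Proof.
move=> Ux; apply/eqP; rewrite -subr_eq0; apply/negPn/negP => w0.
set w := (X in X != 0) in w0.
have wN z : h x w ('d F x z) = 0.
  rewrite bformBl !bformZl (second_form_cst_normal oU oV mG mK sF FU isoF)//.
  by rewrite tension_normal// !mulr0 subr0.
have ww : 0 < h x w w by apply: (metric_pos mK) w0; exact: FU.
pose s := Num.sqrt (h x w w).
have s0 : s != 0 by rewrite gt_eqF// sqrtr_gt0.
have ss : s * s = h x w w by rewrite -expr2 sqr_sqrtr// ltW.
have [lam shapeE] : exists lam : R, shape_operator G K F x (s^-1 *: w) = lam%:M.
  apply: umbilical => //; split=> [|z].
    by rewrite bformZl bformZr -ss mulKf// mulVf.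
  rewrite (metricC mK _ _ (FU Ux)) bformZl.
  by rewrite wN mulr0.
have tauE : h x (tau x) (s^-1 *: w) = lam * m%:R.
  rewrite tensionE// bform_suml.
  rewrite (eq_bigr (fun=> lam)); last first.
    move=> i _; rewrite (shape_scalarE _ _ Ux shapeE).
    by rewrite frame_e.2// eqxx mulr1.
  by rewrite sumr_const card_ord mulr_natr.
have : h x w (s^-1 *: w) = 0.
  rewrite {1}/w bformBl !bformZl (shape_scalarE _ _ Ux shapeE).
  rewrite tauE; move: (bform (G x) u v) => g.
  have -> : g * (c * (lam * m%:R)) = m%:R * c * (lam * g) by ring.
  by rewrite mc1 mul1r subrr.
rewrite bformZr -ss mulKf// => s00.
by rewrite s00 eqxx in s0.
Qed.

End UmbilicalSubmanifold.

(** * Harmonic normal sections of umbilical submanifolds *)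

Section Frame.
Context {R : realType} {m : nat}.
Variables (U : set 'rV[R]_m) (G : 'rV[R]_m -> 'M[R]_m).
Variable e : 'I_m -> 'rV[R]_m -> 'rV[R]_m.
Hypotheses (mG : smooth_metric U G) (frame_e : orthonormal_frame G U e).

(** If [E] is the matrix of rows [e i], orthonormality says that [G *m E^T] is a
    right inverse of [E]; for a square matrix it is also a left inverse, which
    is the expansion. *)
Lemma frame_expansion x v : U x -> v = \sum_i bform (G x) (e i x) v *: e i x.
Proof.
move=> Ux; pose E : 'M[R]_m := \matrix_i e i x.
have EGE : E *m (G x *m E^T) = 1%:M.
  apply/matrixP => i j; rewrite mulmxA [RHS]mxE -(frame_e.2 x Ux i j) /bform.
  rewrite mxE [in RHS]mxE; apply: eq_bigr => k _; rewrite !mxE; congr (_ * _).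
  by apply: eq_bigr => l _; rewrite !mxE.
have := congr1 (mulmx v) (mulmx1C EGE); rewrite mulmx1 => {1}<-.
rewrite mulmxA mulmx_sum_row; apply: eq_bigr => i _; rewrite rowK.
rewrite (metricC mG _ _ Ux) /bform; congr (_ *: _).
rewrite mulmxA mxE [in RHS]mxE; apply: eq_bigr => k _; congr (_ * _).
by rewrite !mxE.
Qed.

End Frame.

(** The tension field is a section [xi] as below, with [c = 1 / m].  Keeping it
    abstract separates the argument from the second derivatives of the map that
    enter its definition. *)
Section UmbilicalSection.
Context {R : realType} {m n : nat}.
Variables (U : set 'rV[R]_m) (V : set 'rV[R]_n).
Variables (G : 'rV[R]_m -> 'M[R]_m) (K : 'rV[R]_n -> 'M[R]_n).
Variable F : 'rV[R]_m -> 'rV[R]_n.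
Variable e : 'I_m -> 'rV[R]_m -> 'rV[R]_m.
Variables (xi : 'rV[R]_m -> 'rV[R]_n) (c : R).
Hypotheses (m_gt0 : (0 < m)%N) (oU : open U) (oV : open V).
Hypotheses (mG : smooth_metric U G) (mK : smooth_metric V K).
Hypotheses (sF : smooth_on U F) (FU : forall x, U x -> V (F x)).
Hypothesis frame_e : orthonormal_frame G U e.

Local Notation h x := (bform (K (F x))).

Hypotheses (sxi : smooth_on U xi) (c_neq0 : c != 0).
Hypothesis xi_normal : forall x w, U x -> h x (xi x) ('d F x w) = 0.
Hypothesis second_form_xi : forall x u v, U x ->
  second_form G K F (cst u) (cst v) x = bform (G x) u v *: (c *: xi x).

Let dF x : U x -> differentiable F x.
Proof. exact: smooth_differentiable. Qed.

Let se i : smooth_on U (e i). Proof. exact: frame_e.1. Qed.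

Let de i x : U x -> differentiable (e i) x.
Proof. exact: smooth_differentiable. Qed.

Hypothesis harmonic : forall x, U x -> rough_laplacian G K F e xi x = 0.

Let phi x := h x (xi x) (xi x).

Let dxi x : U x -> differentiable xi x.
Proof. exact: (smooth_differentiable sxi). Qed.

Let psi i := nabla_along K F (e i) xi.

Let dpsi i x : U x -> differentiable (psi i) x.
Proof.
apply: smooth_differentiable.
by apply: (smooth_nabla_along oU oV mK sF FU) => //; exact: sxi.
Qed.

Let compat X s t x : U x -> differentiable s x -> differentiable t x ->
  'D_(X x) (fun y => h y (s y) (t y)) x
  = h x (nabla_along K F X s x) (t x) + h x (s x) (nabla_along K F X t x).
Proof.
move=> Ux ds dt.
by apply: (metric_compat oV mK) => //; [exact: FU|exact: dF].
Qed.

Lemma derive_energy X x : U x ->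
  'D_(X x) phi x = 2 * h x (nabla_along K F X xi x) (xi x).
Proof.
move=> Ux; rewrite /phi compat//; [|exact: dxi..].
by rewrite [X in _ + X](metricC mK _ _ (FU Ux)) -mulr2n mulr_natl.
Qed.

Lemma nabla_along_push_cst X x w : U x ->
  nabla_along K F X (push F (cst w)) x
  = bform (G x) (X x) w *: (c *: xi x) + 'd F x (Gamma G x (X x) w).
Proof.
move=> Ux; rewrite -second_form_xi// /second_form /nabla.
by rewrite derive_cst add0r /= subrK.
Qed.

(** Differentiate [h(xi, dF w) = 0]. *)
Lemma nabla_along_umbilical_tangent X x w : U x ->
  h x (nabla_along K F X xi x) ('d F x w)
  = - (c * phi x * bform (G x) (X x) w).
Proof.
move=> Ux; have := @compat X xi (push F (cst w)) x Ux (dxi Ux).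
move=> /(_ (push_differentiable oU sF w Ux)).
rewrite (eq_on_derive _ oU (g := fun=> 0) _ Ux); last first.
  by move=> y Uy; exact: xi_normal.
rewrite derive_cst nabla_along_push_cst// => /esym.
rewrite bformDr bformZr bformZr xi_normal//.
rewrite addr0 -/(phi x) => /eqP; rewrite addr_eq0 => /eqP ->.
by rewrite [in RHS]mulrC.
Qed.

Let smooth_energy : smooth_on U phi.
Proof.
apply: smooth_bform => //; [|exact: sxi..].
by move=> i j; exact: (smooth_comp oU FU (metric_smooth mK i j) sF).
Qed.

Lemma derive_frame_cst i x w : U x ->
  'D_(e i x) (fun y => bform (G y) (e i y) w) x
  = bform (G x) (nabla G (e i) (e i) x) w
    + bform (G x) (e i x) (Gamma G x (e i x) w).
Proof.
move=> Ux; rewrite (metric_compat oU mG (e i) (F := id) (zeta := cst w))//.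
  by rewrite /nabla_along !diff_val derive_cst add0r.
exact: de.
Qed.

(** Differentiate the preceding identity for [X = e i] along [e i].  Of the
    factor [3 / 2], a unit comes from the derivative of [phi] and a half from
    the normal part [c g(e_i, w) xi] of the derivative of [dF w], which pairs
    with [nabla_(e_i) xi] to [c g(e_i, w) (D_(e_i) phi) / 2].  The terms in
    [Gamma] cancel each other, and the term in [nabla G (e i) (e i)] is the one
    that the second half of the rough Laplacian removes. *)
Lemma rough_laplacian_tangent i x w : U x ->
  h x (nabla_along K F (e i) (psi i) x
       - nabla_along K F (nabla G (e i) (e i)) xi x) ('d F x w)
  = - (3 / 2 * c * 'D_(e i x) phi x * bform (G x) (e i x) w).
Proof.
move=> Ux; have dw := push_differentiable oU sF w Ux.
have := compat (e i) Ux (dpsi i Ux) dw.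
rewrite (eq_on_derive _ oU (g := fun y =>
    - (c * phi y * bform (G y) (e i y) w)) _ Ux); last first.
  by move=> y Uy; exact: nabla_along_umbilical_tangent.
have dphi : is_derive x (e i x) phi ('D_(e i x) phi x).
  exact/derivableP/diff_derivable/(smooth_differentiable smooth_energy).
have dg : is_derive x (e i x) (fun y => bform (G y) (e i y) w)
    (bform (G x) (nabla G (e i) (e i) x) w
     + bform (G x) (e i x) (Gamma G x (e i x) w)).
  rewrite -derive_frame_cst//; apply/derivableP/diff_derivable.
  apply: smooth_differentiable Ux.
  apply: (smooth_bform (F := id) (zeta := cst w)) => //.
    exact: (metric_smooth mG).
  exact: smooth_cst.
have -> : (fun y => - (c * phi y * bform (G y) (e i y) w))
    = - ((c *: phi) * (fun y => bform (G y) (e i y) w)) by [].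
rewrite derive_val.
have E2 : h x (psi i x) (nabla_along K F (e i) (push F (cst w)) x)
    = bform (G x) (e i x) w * (c * h x (psi i x) (xi x))
      - c * phi x * bform (G x) (e i x) (Gamma G x (e i x) w).
  rewrite nabla_along_push_cst// bformDr !bformZr; congr (_ + _).
  exact: nabla_along_umbilical_tangent.
have E3 := nabla_along_umbilical_tangent (nabla G (e i) (e i)) w Ux.
have E4 : 'D_(e i x) phi x = 2 * h x (psi i x) (xi x) := derive_energy (e i) Ux.
rewrite {}E2 bformBl {}E3.
rewrite /GRing.scale /= E4.
move: (bform _ (nabla_along K F (e i) (psi i) x) _) => A.
have solve D p g g1 g2 :
    - (c * p * (g1 + g2) + g * (c * (2 * D)))
    = A + (g * (c * D) - c * p * g2) ->
    A - - (c * p * g1) = - (3 / 2 * c * (2 * D) * g) by move=> ?; lra.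
exact: solve.
Qed.

(** The tangential part of [Delta xi = 0], tested against the frame itself; the
    frame spans all directions. *)
Lemma energy_locally_constant x v : U x -> 'D_v phi x = 0.
Proof.
move=> Ux.
have De k : 'D_(e k x) phi x = 0.
  have := congr1 (fun w => h x w ('d F x (e k x))) (harmonic Ux).
  rewrite /rough_laplacian /= bformNl bform_suml bform0l.
  under eq_bigr do rewrite rough_laplacian_tangent// frame_e.2//.
  rewrite (bigD1 k)//= big1 => [|i ik]; last by rewrite (negbTE ik) mulr0 oppr0.
  rewrite eqxx mulr1 addr0 opprK => /eqP; rewrite mulf_eq0 => /orP[|/eqP//].
  rewrite mulf_eq0 (negbTE c_neq0) orbF => /eqP; lra.
have dphi := smooth_differentiable smooth_energy Ux.
rewrite (frame_expansion mG frame_e v Ux) deriveE// linear_sum big1// => i _.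
by rewrite linearZ /= -deriveE// De scaler0.
Qed.

(** With [phi] constant, the part of [Delta xi = 0] along [xi] is a sum of
    squares, so [xi] is parallel; but a parallel [xi] has zero tangential
    derivative, and that is [- c phi g]. *)
Lemma umbilical_section_eq0 x : U x -> xi x = 0.
Proof.
move=> Ux.
have pxi X y : U y -> h y (nabla_along K F X xi y) (xi y) = 0.
  move=> Uy; have := derive_energy X Uy; rewrite energy_locally_constant//.
  by move=> /esym/eqP; rewrite mulf_eq0 pnatr_eq0 => /eqP.
have pp i : h x (nabla_along K F (e i) (psi i) x) (xi x)
    = - h x (psi i x) (psi i x).
  have := compat (e i) Ux (dpsi i Ux) (dxi Ux).
  rewrite (eq_on_derive _ oU (g := fun=> 0) _ Ux); last first.
    by move=> y Uy; exact: pxi.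
  by rewrite derive_cst => /esym/eqP; rewrite addr_eq0 => /eqP.
have := congr1 (fun w => h x w (xi x)) (harmonic Ux).
rewrite /rough_laplacian /= bformNl bform_suml bform0l.
under eq_bigr do rewrite bformBl pxi// subr0 pp.
rewrite sumrN opprK => /eqP.
have pos w : 0 <= h x w w.
  have [->|w0] := eqVneq w 0; first by rewrite bform0l.
  by apply/ltW/(metric_pos mK) => //; exact: FU.
rewrite psumr_eq0 => [/allP psi0|i _]; last exact: pos.
pose i := Ordinal m_gt0.
have psi_i : psi i x = 0.
  apply: contraTeq (psi0 i (mem_index_enum _)) => w0.
  by rewrite gt_eqF// (metric_pos mK)//; exact: FU.
have := nabla_along_umbilical_tangent (e i) (e i x) Ux.
rewrite -/(psi i) psi_i bform0l frame_e.2// eqxx mulr1 => /esym/eqP.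
rewrite oppr_eq0 mulf_eq0 (negbTE c_neq0) /= => /eqP phi0.
apply/eqP; apply: contra_eqT phi0 => t0.
by rewrite gt_eqF// (metric_pos mK)//; exact: FU.
Qed.

End UmbilicalSection.

(** * From charts to manifolds *)

Section ZeroSection.
Context {R : realType} {m n : nat}.
Variables (U : set 'rV[R]_m).
Variables (G : 'rV[R]_m -> 'M[R]_m) (K : 'rV[R]_n -> 'M[R]_n).
Variables (F : 'rV[R]_m -> 'rV[R]_n) (e : 'I_m -> 'rV[R]_m -> 'rV[R]_m).
Hypothesis oU : open U.

Lemma nabla_along_eq0 X xi x :
  (forall y, U y -> xi y = 0) -> U x -> nabla_along K F X xi x = 0.
Proof.
move=> xi0 Ux; rewrite /nabla_along xi0// Gamma0r addr0.
by rewrite (eq_on_derive _ oU xi0 Ux) derive_cst.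
Qed.

Lemma rough_laplacian_eq0 xi x :
  (forall y, U y -> xi y = 0) -> U x -> rough_laplacian G K F e xi x = 0.
Proof.
move=> xi0 Ux; rewrite /rough_laplacian big1 ?oppr0// => i _.
rewrite (@nabla_along_eq0 _ xi)// subr0 nabla_along_eq0// => y Uy.
exact: nabla_along_eq0.
Qed.

Lemma tension_dim0 x : m = 0%N -> tension G K F e x = 0.
Proof.
move=> m0; rewrite /tension big1// => i _; exfalso.
by have := leq_ltn_trans (leq0n i) (ltn_ord i); rewrite m0.
Qed.

End ZeroSection.

Section LocalExpression.
Context {R : realType} {m n : nat}.
Variables (M : riemannian_manifold R m) (N : riemannian_manifold R n).
Variables (iota : M -> N) (c : chart R m M) (d : chart R n N).
Hypotheses (ac : atlas c) (ad : atlas d).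

Lemma local_dom_sub_img : local_dom iota c d `<=` img c.
Proof. by move=> _ [p [cp _] <-]; exists p. Qed.

Lemma local_map_img x : local_dom iota c d x -> img d (local_map iota c d x).
Proof.
move=> [p [cp dp] <-]; exists (iota p) => //.
by rewrite /local_map /= coordK.
Qed.

Lemma gram_smooth_metric : smooth_metric (img c) (gram c).
Proof. by split; [exact: gram_smooth|exact: gram_sym|exact: gram_posdef]. Qed.

End LocalExpression.

Lemma smooth_metric_subset (R : realType) n (U U' : set 'rV[R]_n) K :
  U' `<=` U -> smooth_metric U K -> smooth_metric U' K.
Proof.
move=> U'U mK; split=> [i j|y /U'U|y /U'U].
- exact: smooth_subset U'U (metric_smooth mK i j).
- exact: (metric_sym mK).
- exact: (metric_pos mK).
Qed.

Section UmbilicalTension.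
Context {R : realType} {m n : nat}.
Variables (M : riemannian_manifold R m) (N : riemannian_manifold R n).
Variable iota : M -> N.
Hypothesis submanifold_iota : riemannian_submanifold iota.

Lemma H_tensional_minimal :
  totally_umbilical iota -> H_tensional iota -> minimal iota.
Proof.
have [_ [[_ smooth_iota] _] isometric_iota] := submanifold_iota.
move=> umbilical_iota harmonic c d ac ad U e oU Usub frame_e x Ux.
rewrite /mean_curvature; have [m0|m_gt0] := posnP m.
  by rewrite tension_dim0// scaler0.
have oV : open (img d) := @img_open _ _ _ d.
have mG : smooth_metric U (gram c).
  apply: smooth_metric_subset (gram_smooth_metric ac).
  exact: subset_trans Usub (@local_dom_sub_img _ _ _ _ _ iota c d).
have mK := gram_smooth_metric ad.
have sF := smooth_subset Usub (smooth_iota _ _ ac ad).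
have FU y (Uy : U y) := local_map_img (Usub _ Uy).
have isoF y (Uy : U y) := isometric_iota _ _ ac ad _ (Usub _ Uy).
have umb y (Uy : U y) := umbilical_iota _ _ ac ad _ (Usub _ Uy).
suff -> : tension (gram c) (gram d) (local_map iota c d) e x = 0.
  by rewrite scaler0.
apply: (umbilical_section_eq0 (c := m%:R^-1) m_gt0 oU oV mG mK sF FU frame_e)
  => //.
- exact: (smooth_tension oU oV mG mK sF FU frame_e).
- by rewrite invr_eq0 pnatr_eq0 -lt0n.
- by move=> y w; exact: (tension_normal oU oV mG mK sF FU isoF frame_e).
- move=> y u v.
  exact: (umbilical_second_form m_gt0 oU oV mG mK sF FU isoF frame_e umb).
- by move=> y Uy; exact: (harmonic _ _ ac ad U).
Qed.

Lemma minimal_H_tensional : minimal iota -> H_tensional iota.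
Proof.
move=> min c d ac ad U e oU Usub frame_e x Ux.
apply: (rough_laplacian_eq0 _ _ _ _ oU) => // y Uy.
have /eqP := min c d ac ad U e oU Usub frame_e y Uy.
rewrite scaler_eq0 invr_eq0 pnatr_eq0 => /orP[/eqP m0|/eqP//].
exact: tension_dim0.
Qed.

End UmbilicalTension.

Theorem theorem5p5 (R : realType) (m : nat)
  (M : riemannian_manifold R m) (N : riemannian_manifold R m.+1)
  (iota : M -> N)
  (submanifold_iota : riemannian_submanifold iota)
  (einstein_N : einstein N)
  (umbilical_iota : totally_umbilical iota) :
  H_tensional iota <-> minimal iota.
Proof.
split; last exact: minimal_H_tensional.
exact: H_tensional_minimal.
Qed.
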